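(* Let $\mu$ be a nilpotent Lie algebra bracket on $\mathfrak{n}=\mathbb{C}^n$ and let $\mathfrak{h}$ be an ideal of $\mathfrak{n}$ of codimension $2$ containing the commutator $[\mathfrak{n},\mathfrak{n}]$. Let $\langle x_0,x_1\rangle$ be a direct complement to $\mathfrak{h}$, so that $\mathfrak{n}=\langle x_0,x_1\rangle\oplus\mathfrak{h}$. If $D$ is a derivation of the Lie algebra $\mathfrak{h}$ such that $D\operatorname{ad}(x_0)=\operatorname{ad}(x_0)D$ on $\mathfrak{h}$, then the alternating bilinear map $\varphi_D:\mathfrak n\times\mathfrak n\to\mathfrak n$ defined by $$\varphi_D(x_0,x_1)=0,\quad \varphi_D(x_0,h)=0,\quad \varphi_D(x_1,h)=D(h),\quad \varphi_D(h,h')=0,\qquad h,h'\in\mathfrak{h},$$ is a Lie algebra bracket and a 2-cocycle for $\mu$. Therefore $\mu_t=\mu+t\varphi_D$ is a linear deformation of $\mu$.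
   Context: Here $\operatorname{ad}(x_0)=\mu(x_0,\cdot)$. For bilinear maps $\psi,\phi$, define the trilinear map $\psi\circ\phi(X,Y,Z)=\psi(\phi(X,Y),Z)+\psi(\phi(Y,Z),X)+\psi(\phi(Z,X),Y)$. An alternating bilinear map $\varphi$ is a Lie algebra (bracket) if $\varphi\circ\varphi=0$. It is a 2-cocycle for $\mu$ if $\mu\circ\varphi+\varphi\circ\mu=0$. A linear deformation of $\mu$ is a family of Lie algebra brackets of the form $\mu_t=\mu+t\varphi$, with $t$ a complex parameter ($\mu_t$ satisfies the Jacobi identity for all $t\in\mathbb{C}$). *)

(* Defs.v *)
From mathcomp Require Export all_boot all_order all_algebra.
From mathcomp Require Export complex reals.

Set Implicit Arguments.
Unset Strict Implicit.
Unset Printing Implicit Defensive.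

Import GRing.Theory.
Local Open Scope ring_scope.

Section Brackets.
Variables (F : fieldType) (V : vectType F).
Implicit Types (psi phi mu : V -> V -> V) (x y z : V) (h U W X : {vspace V}).

Definition alternating_bilinear psi : Prop :=
  (forall y, linear (psi^~ y)) /\ (forall x, linear (psi x)) /\
  (forall x, psi x x = 0).

Definition circ psi phi x y z : V :=
  psi (phi x y) z + psi (phi y z) x + psi (phi z x) y.

Definition is_lie_bracket psi : Prop :=
  alternating_bilinear psi /\ forall x y z, circ psi psi x y z = 0.

Definition is_2cocycle mu phi : Prop :=
  alternating_bilinear phi /\
  forall x y z, circ mu phi x y z + circ phi mu x y z = 0.

Definition pencil mu phi (t : F) : V -> V -> V :=
  fun x y => mu x y + t *: phi x y.

Definition is_linear_deformation mu (mu_ : F -> V -> V -> V) : Prop :=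
  (exists phi, forall t x y, mu_ t x y = pencil mu phi t x y) /\
  (forall t, is_lie_bracket (mu_ t)).

Definition ad mu x : V -> V := mu x.

(* The span of all mu u w with u in U and w in W, independent of the bases
   chosen when mu is bilinear: see bracketv_subP. *)
Definition bracketv mu U W : {vspace V} :=
  <<[seq mu u w | u <- vbasis U, w <- vbasis W]>>%VS.

Lemma bracketv_subP mu U W X : alternating_bilinear mu ->
  (forall u w, u \in U -> w \in W -> mu u w \in X) <->
  (bracketv mu U W <= X)%VS.
Proof.
move=> [mul [mur _]]; split=> [muX | sX u w Uu Ww].
  apply/span_subvP => _ /allpairsP[[u w] /= [Uu Ww ->]].
  by apply: muX; apply: vbasis_mem.
have add_closed f v n (b : n.-tuple V) : linear f ->
  v \in <<b>>%VS -> (forall e, e \in b -> f e \in X) -> f v \in X.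
  move=> lf /coord_span -> fX.
  elim/big_rec: _ => [|i y _ Xy].
    by have := lf (-1) 0 0; rewrite scaler0 addr0 scaleN1r addNr => ->; apply: mem0v.
  by rewrite lf rpredD // rpredZ // fX // mem_nth // size_tuple.
apply: (add_closed (mu^~ w) u _ (vbasis U)) => //.
  by rewrite (span_basis (vbasisP U)).
move=> e Ue; apply: (add_closed (mu e) w _ (vbasis W)) => //.
  by rewrite (span_basis (vbasisP W)).
move=> e' We'; apply: (subvP sX); apply: memv_span.
by apply/allpairsP; exists (e, e').
Qed.

Fixpoint lower_central mu (k : nat) : {vspace V} :=
  if k is k'.+1 then bracketv mu fullv (lower_central mu k') else fullv.

Definition is_nilpotent mu : Prop := exists k, lower_central mu k = 0%VS.

Definition is_ideal mu h : Prop := forall x u, u \in h -> mu x u \in h.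

(* vsproj h is a projection of V onto h; it only retypes its argument in the
   next two definitions when h is an ideal (see ad_onE and bracket_onE). *)
Definition ad_on mu h x (u : subvs_of h) : subvs_of h :=
  vsproj h (ad mu x (vsval u)).

Definition bracket_on mu h (u v : subvs_of h) : subvs_of h :=
  vsproj h (mu (vsval u) (vsval v)).

Lemma ad_onE mu h x (u : subvs_of h) :
  is_ideal mu h -> vsval (ad_on mu x u) = ad mu x (vsval u).
Proof. by move=> idh; rewrite vsprojK // idh // subvsP. Qed.

Lemma bracket_onE mu h (u v : subvs_of h) :
  is_ideal mu h -> vsval (bracket_on mu u v) = mu (vsval u) (vsval v).
Proof. by move=> idh; rewrite vsprojK // idh // subvsP. Qed.

Definition is_phi h x0 x1 (D : 'End(subvs_of h)) phi : Prop :=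
  [/\ alternating_bilinear phi,
      phi x0 x1 = 0,
      forall u : subvs_of h, phi x0 (vsval u) = 0,
      forall u : subvs_of h, phi x1 (vsval u) = vsval (D u)
    & forall u v : subvs_of h, phi (vsval u) (vsval v) = 0].

End Brackets.

Definition is_derivation (F : fieldType) (L : vectType F)
    (br : L -> L -> L) (D : 'End(L)) : Prop :=
  forall u v, D (br u v) = br (D u) v + br u (D v).

(* Main.v *)
Require Import Defs.
From mathcomp Require Import ring.
From mathcomp Require boolp.

Set Implicit Arguments.
Unset Strict Implicit.
Unset Printing Implicit Defensive.

Import GRing.Theory.
Local Open Scope ring_scope.

(** Let [b] be the [x1]-coordinate along [<x0, x1> + h] and [d] the extension of
    [D] by zero on [x0] and [x1]. The map of the statement is the wedge
    [phi x y = b x *: d y - b y *: d x]. Since [b] vanishes on [h], which contains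
    the image of [d] and all brackets, the Jacobi sum of [phi] cancels, and the
    cocycle sum is minus the cyclic sum of [b x *: Delta y z], where [Delta] is
    the failure of [d] to be a derivation of [mu]. The hypotheses on [D] say that
    [Delta] vanishes on [ker b = <x0> + h], so [Delta y z = b y *: E z - b z *: E y]
    with [E = Delta x1], and the cyclic sum cancels. *)

Section AlternatingMaps.
Variables (F : fieldType) (V : vectType F).
Implicit Types (psi phi mu : V -> V -> V) (h : {vspace V}).

(** Coordinates are linear forms. This turns identities between vectors into identities between
    scalars, which [ring] decides. *)
Lemma eq_functionals (u v : V) : (forall f : {scalar V}, f u = f v) -> u = v.
Proof.
move=> uv; rewrite (coord_vbasis (memvf u)) (coord_vbasis (memvf v)).
by apply: eq_bigr => i _; rewrite uv.
Qed.

(** * Calculus of alternating bilinear maps *)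

Section Bilinear.
Variable psi : V -> V -> V.
Hypothesis psiA : alternating_bilinear psi.

Lemma alt_linearl y : linear (psi^~ y). Proof. by case: psiA. Qed.

Lemma alt_linearr x : linear (psi x). Proof. by case: psiA => _ []. Qed.

Lemma altxx x : psi x x = 0. Proof. by case: psiA => _ []. Qed.

Lemma altDl x y z : psi (x + y) z = psi x z + psi y z.
Proof. by have := alt_linearl z 1 x y; rewrite !scale1r. Qed.

Lemma altDr x y z : psi x (y + z) = psi x y + psi x z.
Proof. by have := alt_linearr x 1 y z; rewrite !scale1r. Qed.

Lemma alt0l z : psi 0 z = 0.
Proof. by have := alt_linearl z (-1) 0 0; rewrite scaler0 addr0 scaleN1r addNr. Qed.

Lemma alt0r z : psi z 0 = 0.
Proof. by have := alt_linearr z (-1) 0 0; rewrite scaler0 addr0 scaleN1r addNr. Qed.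

Lemma altZl a x z : psi (a *: x) z = a *: psi x z.
Proof. by have := alt_linearl z a x 0; rewrite !addr0 alt0l addr0. Qed.

Lemma altZr a x z : psi x (a *: z) = a *: psi x z.
Proof. by have := alt_linearr x a z 0; rewrite !addr0 alt0r addr0. Qed.

Lemma altNl x z : psi (- x) z = - psi x z.
Proof. by rewrite -scaleN1r altZl scaleN1r. Qed.

Lemma altNr x z : psi x (- z) = - psi x z.
Proof. by rewrite -scaleN1r altZr scaleN1r. Qed.

Lemma altC x y : psi x y = - psi y x.
Proof.
by apply/eqP; rewrite -addr_eq0 -(altxx (x + y)) altDl !altDr !altxx add0r addr0.
Qed.

Definition altE := (altDl, altDr, altZl, altZr, altNl, altNr).

(** The projection [w - b w *: x1] lands in the kernel of [b]. Expanding [psi] at the projections of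
    [y] and [z] gives the formula, since [psi x1 x1] vanishes. *)
Lemma alt_vanish_kernel (b : {scalar V}) x1 : b x1 = 1 ->
    (forall y z, b y = 0 -> b z = 0 -> psi y z = 0) ->
  forall y z, psi y z = b y *: psi x1 z - b z *: psi x1 y.
Proof.
move=> b1 psi0 y z.
have bK w : b (w - b w *: x1) = 0 by rewrite linearB linearZ /= b1 mulr1 subrr.
apply/eqP; rewrite -subr_eq0; apply/eqP; rewrite -(psi0 _ _ (bK y) (bK z)).
rewrite !altE altxx (altC y x1); move: (b y) (b z) => p q.
by apply: eq_functionals => f; rewrite !linearE /=; ring.
Qed.

End Bilinear.

(** * Pencils of brackets *)

Lemma pencil_alternating mu phi t : alternating_bilinear mu ->
  alternating_bilinear phi -> alternating_bilinear (pencil mu phi t).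
Proof.
move=> muA phiA; rewrite /pencil; split; [|split] => [y a u v|x a u v|x].
- rewrite /= !(altE muA) !(altE phiA); apply: eq_functionals => f.
  by rewrite !linearE /=; ring.
- rewrite /= !(altE muA) !(altE phiA); apply: eq_functionals => f.
  by rewrite !linearE /=; ring.
- by rewrite !altxx // scaler0 addr0.
Qed.

(** For bilinear maps, [circ] is itself bilinear in the pair of maps, so the Jacobi sum of the
    pencil is a quadratic polynomial in [t]. *)
Lemma circ_pencil mu phi t x y z :
    alternating_bilinear mu -> alternating_bilinear phi ->
  circ (pencil mu phi t) (pencil mu phi t) x y z =
    circ mu mu x y z + t *: (circ mu phi x y z + circ phi mu x y z)
    + t ^+ 2 *: circ phi phi x y z.
Proof.
move=> muA phiA; rewrite /circ /pencil !(altE muA) !(altE phiA).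
by apply: eq_functionals => f; rewrite !linearE /=; ring.
Qed.

Lemma pencil_linear_deformation mu phi : is_lie_bracket mu ->
  is_lie_bracket phi -> is_2cocycle mu phi ->
  is_linear_deformation mu (pencil mu phi).
Proof.
move=> [muA muJ] [phiA phiJ] [_ cocyc]; split; first by exists phi.
move=> t; split=> [|x y z]; first exact: pencil_alternating.
by rewrite circ_pencil // muJ phiJ cocyc !scaler0 !addr0.
Qed.

(** * The wedge of a linear form and an endomorphism *)

Section Wedge.
Variables (b : {scalar V}) (d : {linear V -> V}).

Definition wedge x y : V := b x *: d y - b y *: d x.

Lemma wedge_alternating : alternating_bilinear wedge.
Proof.
rewrite /wedge; split; [|split] => [y a u v|x a u v|x]; last exact: subrr.
- by apply: eq_functionals => f; rewrite /= !linearE /=; ring.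
- by apply: eq_functionals => f; rewrite /= !linearE /=; ring.
Qed.

Lemma wedge_lie : (forall x, b (d x) = 0) -> is_lie_bracket wedge.
Proof.
move=> bd0; split=> [|x y z]; first exact: wedge_alternating.
(* Since [b] kills the image of [d], only the term in [d (wedge u v)] survives. In the cyclic sum
   each [d (d _)] then occurs twice with opposite signs. *)
have wedgeK u v w :
    wedge (wedge u v) w = (b w * b v) *: d (d u) - (b w * b u) *: d (d v).
  have bw0 : b (wedge u v) = 0.
    by rewrite linearB !linearZ /= !bd0 !mulr0 subrr.
  have dw : d (wedge u v) = b u *: d (d v) - b v *: d (d u).
    by rewrite linearB !linearZ.
  by rewrite {1}/wedge bw0 dw scale0r sub0r scalerBr !scalerA opprB.
rewrite /circ !wedgeK.
by apply: eq_functionals => f; rewrite !linearE /=; ring.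
Qed.

(** Up to sign, the Chevalley-Eilenberg coboundary of the 1-cochain [d] with adjoint
    coefficients. *)
Definition derivation_defect mu x y : V := d (mu x y) - mu (d x) y - mu x (d y).

Lemma derivation_defect_alternating mu : alternating_bilinear mu ->
  alternating_bilinear (derivation_defect mu).
Proof.
move=> muA; rewrite /derivation_defect; split; [|split] => [y a u v|x a u v|x].
- rewrite /= !linearP !(altE muA); apply: eq_functionals => f.
  by rewrite !linearE /=; ring.
- rewrite /= !linearP !(altE muA); apply: eq_functionals => f.
  by rewrite !linearE /=; ring.
- by rewrite altxx // linear0 (altC muA x) opprK sub0r addNr.
Qed.

Lemma wedge_cocycle mu (E : V -> V) : alternating_bilinear mu ->
    (forall x y, b (mu x y) = 0) ->
    (forall y z, derivation_defect mu y z = b y *: E z - b z *: E y) ->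
  is_2cocycle mu wedge.
Proof.
move=> muA bmu0 defE; split=> [|x y z]; first exact: wedge_alternating.
have dmu u v : d (mu u v) = b u *: E v - b v *: E u + mu (d u) v + mu u (d v).
  by rewrite -defE /derivation_defect addrAC !subrK.
rewrite /circ /wedge !bmu0 !dmu !(altE muA).
(* Moving [d] to the first slot everywhere makes cancelling terms the same atom for [ring]. *)
rewrite (altC muA x) (altC muA y (d z)) (altC muA z (d x)).
move: (b x) (b y) (b z) => p q r.
by apply: eq_functionals => f; rewrite !linearE /=; ring.
Qed.

End Wedge.

(** * Ideals of codimension two *)

Section Complement.
Variables (h : {vspace V}) (x0 x1 : V).
Hypothesis dim_h : (\dim h + 2)%N = \dim {:V}.
Hypothesis sum_h : (<<[:: x0; x1]>> + h)%VS = fullv.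
Hypothesis dir_h : directv (<<[:: x0; x1]>> + h).

Lemma complement_coordinates (D : 'End(subvs_of h)) :
  exists (b : {scalar V}) (d : {linear V -> V}),
  [/\ [/\ b x0 = 0, b x1 = 1 & forall u, u \in h -> b u = 0],
      [/\ d x0 = 0, d x1 = 0 & forall u : subvs_of h, d (vsval u) = vsval (D u)],
      forall z, d z \in h
    & forall z, b z = 0 -> exists a (u : subvs_of h), z = a *: x0 + vsval u].
Proof.
move: sum_h dir_h; set U := <<[:: x0; x1]>>%VS => sumU dirU.
pose X := [tuple x0; x1].
have capUh : (U :&: h = 0)%VS by apply/directv_addP.
have caphU : (h :&: U = 0)%VS by rewrite capvC.
(* Directness gives [U] the dimension [\dim {:V} - \dim h = 2], so its two generators are
   independent. *)
have freeX : free X.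
  rewrite /free /= -/U -(eqn_add2l (\dim h)) dim_h -sumU addnC eq_sym.
  by apply/eqP/(directvP dirU).
have Ux0 : x0 \in U by rewrite memv_span ?inE ?eqxx.
have Ux1 : x1 \in U by rewrite memv_span ?inE ?eqxx ?orbT.
(* A vector of [V2] is its own [V2]-component, which leaves nothing for [V1]. *)
have pi_other V1 V2 u : (V1 :&: V2 = 0)%VS -> u \in V2 -> daddv_pi V1 V2 u = 0.
  move=> dx V2u; have := daddv_pi_add dx (subvP (addvSr V1 V2) u V2u).
  rewrite (@daddv_pi_id _ _ V2) 1?capvC // => /eqP.
  by rewrite -subr_eq0 addrK => /eqP.
(* Indices start at 0, so [coord X 1] reads the coefficient of [x1]. In [d], [vsproj h] retypes the
   [h]-component so that [D] applies to it. *)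
pose b : {scalar V} := coord X 1 \o daddv_pi U h.
pose d : {linear V -> V} := vsval \o D \o vsproj h \o daddv_pi h U.
exists b, d; split.
- split=> [||u hu]; rewrite /b /=.
  + by rewrite daddv_pi_id // (coord_free 0 _ freeX).
  + by rewrite daddv_pi_id // (coord_free 1 _ freeX).
  + by rewrite pi_other // linear0.
- split=> [||u]; rewrite /d /=.
  + by rewrite pi_other // !linear0.
  + by rewrite pi_other // !linear0.
  + by rewrite daddv_pi_id ?subvsP // vsvalK.
- by move=> z; rewrite /d /= subvsP.
- move=> z; rewrite /b /= => bz0.
  exists (coord X 0 (daddv_pi U h z)), (vsproj h (daddv_pi h U z)).
  rewrite vsprojK ?memv_pi // -[LHS](daddv_pi_add capUh) ?sumU ?memvf //.
  congr (_ + _); rewrite {1}(coord_span (memv_pi U h z)).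
  have lift1 : lift ord0 ord0 = 1 :> 'I_2 by apply: val_inj.
  by rewrite (big_ord_recl 1) big_ord1 /= lift1 bz0 scale0r addr0.
Qed.

Variables (mu : V -> V -> V) (D : 'End(subvs_of h)).
Hypothesis mu_lie : is_lie_bracket mu.
Hypothesis h_ideal : is_ideal mu h.
Hypothesis h_commutator : (bracketv mu fullv fullv <= h)%VS.
Hypothesis D_der : is_derivation (@bracket_on _ _ mu h) D.
Hypothesis D_ad : forall u : subvs_of h, D (ad_on mu x0 u) = ad_on mu x0 (D u).

Lemma codim2_deformation :
  (exists! phi, is_phi x0 x1 D phi) /\
  (forall phi, is_phi x0 x1 D phi ->
     [/\ is_lie_bracket phi,
         is_2cocycle mu phi
       & is_linear_deformation mu (pencil mu phi)]).
Proof.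
have [b [d [[b0 b1 bh] [d0 d1 dh] d_in kerb]]] := complement_coordinates D.
have muA : alternating_bilinear mu by case: mu_lie.
have mu_in x y : mu x y \in h.
  by apply: (proj2 (bracketv_subP _ _ _ muA) h_commutator); rewrite memvf.
(* Stated for general [psi] because it serves twice: for [phi], giving uniqueness, and for the
   defect of [d], giving the cocycle condition. *)
have expand psi : alternating_bilinear psi ->
    (forall u : subvs_of h, psi x0 (vsval u) = 0) ->
    (forall u v : subvs_of h, psi (vsval u) (vsval v) = 0) ->
    forall y z, psi y z = b y *: psi x1 z - b z *: psi x1 y.
  move=> psiA psi0 psih; apply: alt_vanish_kernel => // y z.
  move=> /kerb [a [u ->]] /kerb [c [v ->]].
  rewrite !(altE psiA) altxx // psih psi0 (altC psiA _ x0) psi0.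
  by rewrite !(oppr0, scaler0, addr0).
have phi_wedge phi : is_phi x0 x1 D phi -> phi = wedge b d.
  case=> phiA phi01 phi0 phi1 phih.
  (* Write [z] as [a *: x0 + u + b z *: x1] with [u] in [h]; [phi x1] and [d] agree on each
     summand. *)
  have phi1E z : phi x1 z = d z.
    have /kerb[a [u zE]] : b (z - b z *: x1) = 0.
      by rewrite linearB linearZ /= b1 mulr1 subrr.
    rewrite -(subrK (b z *: x1) z) zE !(altE phiA) altxx // phi1.
    by rewrite (altC phiA x1 x0) phi01 !linearD !linearZ /= d0 d1 dh oppr0.
  apply: boolp.funext => y; apply: boolp.funext => z.
  by rewrite (expand phi) // !phi1E.
have wedge_phi : is_phi x0 x1 D (wedge b d).
  rewrite /wedge; split=> [||u|u|u v].
  - exact: wedge_alternating.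
  - by rewrite b0 d0 scale0r scaler0 subrr.
  - by rewrite b0 d0 scale0r scaler0 subrr.
  - by rewrite b1 d1 dh scale1r scaler0 subr0.
  - by rewrite !bh ?subvsP // !scale0r subrr.
have wedgeL : is_lie_bracket (wedge b d) by apply: wedge_lie => x; apply: bh.
have wedgeC : is_2cocycle mu (wedge b d).
  apply: (@wedge_cocycle _ _ _ (derivation_defect d mu x1)) => // [x y|].
    exact: bh.
  apply: expand => [|u|u v]; first exact: derivation_defect_alternating.
  (* Read in [V], commutation with [ad x0] says that [d (mu x0 u) = mu x0 (d u)]. The remaining term
     of the defect vanishes because [d x0 = 0]. *)
  - have := congr1 vsval (D_ad u); rewrite -dh !ad_onE // /ad => dmu.
    by rewrite /derivation_defect dmu d0 alt0l // subr0 dh subrr.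
  (* On [h] the map [d] is [D], and the Leibniz rule for [D] kills the defect. *)
  - have := congr1 vsval (D_der u v); rewrite linearD /= -dh !bracket_onE //.
    by move=> dmu; rewrite /derivation_defect dmu !dh addrAC addrK subrr.
split; first by exists (wedge b d); split=> // phi /phi_wedge.
by move=> phi /phi_wedge ->; split=> //; apply: pencil_linear_deformation.
Qed.

End Complement.
End AlternatingMaps.

Theorem proposition2p1 (R : realType) (n : nat)
    (mu : 'rV[R[i]]_n -> 'rV[R[i]]_n -> 'rV[R[i]]_n)
    (h : {vspace 'rV[R[i]]_n}) (x0 x1 : 'rV[R[i]]_n)
    (D : 'End(subvs_of h)) :
  is_lie_bracket mu ->
  is_nilpotent mu ->
  is_ideal mu h ->
  (\dim h + 2)%N = n ->
  (bracketv mu fullv fullv <= h)%VS ->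
  (<<[:: x0; x1]>> + h)%VS = fullv ->
  directv (<<[:: x0; x1]>> + h) ->
  is_derivation (@bracket_on _ _ mu h) D ->
  (forall u : subvs_of h, D (ad_on mu x0 u) = ad_on mu x0 (D u)) ->
  (exists! phi, is_phi x0 x1 D phi) /\
  (forall phi, is_phi x0 x1 D phi ->
     [/\ is_lie_bracket phi,
         is_2cocycle mu phi
       & is_linear_deformation mu (pencil mu phi)]).
Proof.
move=> mu_lie _ h_ideal dim_h h_comm sum_h dir_h D_der D_ad.
apply: codim2_deformation => //.
(* Row vectors are 1 by [n] matrices, so their dimension unfolds to [1 * n]. *)
by rewrite dimvf /dim /= mul1n.
Qed.
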